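(* For every real number $\epsilon$ with $0<\epsilon<\frac{1}{2}$, there exists an integer $\delta_0$ such that every tournament $T$ with $\delta^+(T)\geq\delta_0$ admits a bisection $(A,B)$ of $V(T)$ with $\min\{d_A^+(v), d_B^+(v)\}\geq \left(\frac{1}{2}-\epsilon\right) d_T^+(v)$ for every $v\in V(T)$.
   Context: All digraphs are finite and simple (no loops, no multiple arcs). A tournament is an orientation of a complete graph. For a digraph $T$, $d_T^+(v)$ is the out-degree of $v$ in $T$ and $\delta^+(T)$ is the minimum out-degree of $T$. For a set $A$ of vertices, $d_A^+(v)$ denotes the number of out-neighbors of $v$ lying in $A$ (here $v$ may or may not belong to $A$). A bipartition $(A,B)$ of $V(T)$ is a partition of $V(T)$ into two disjoint sets $A$ and $B$; a bisection is a bipartition $(A,B)$ with $\big||A|-|B|\big|\leq 1$. *)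

(* Defs.v *)
(* The real numbers are an arbitrary [R : realType]. *)
From mathcomp Require Import all_boot all_order all_algebra.
From mathcomp Require Import reals.

Set Implicit Arguments.
Unset Strict Implicit.
Unset Printing Implicit Defensive.

Import Order.TTheory GRing.Theory Num.Theory.

Local Open Scope nat_scope.

(* A simple digraph on the finite vertex set [T] is its arc relation [e]:
   [e u v] means that u -> v is an arc. *)

Definition tournament (T : finType) (e : rel T) : Prop :=
  irreflexive e /\ forall u v : T, u != v -> e u v (+) e v u.

Definition outdeg_in (T : finType) (e : rel T) (A : {set T}) (v : T) : nat :=
  #|[set u in A | e v u]|.

Definition outdeg (T : finType) (e : rel T) (v : T) : nat :=
  outdeg_in e [set: T] v.

(* In a loopless digraph every out-degree is < #|T|, so the default value #|T|
   does not affect the minimum when T is nonempty; it is 0 when T is empty. *)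
Definition min_outdeg (T : finType) (e : rel T) : nat :=
  \big[minn/#|T|]_(v : T) outdeg e v.

(* The two parts are allowed to be empty. *)
Definition bipartition (T : finType) (A B : {set T}) : Prop :=
  A :|: B = [set: T] /\ [disjoint A & B].

Definition bisection (T : finType) (A B : {set T}) : Prop :=
  bipartition A B /\ (`| #|A|%:Z - #|B|%:Z | <= 1)%R.

(* Main.v *)
(* In a tournament every vertex set S spans a vertex with at least (|S| - 1) / 2
   out-neighbours in S, so out-degrees grow linearly and the sum over v of
   exp (- k d(v)) tends to 0 as the minimum out-degree tends to infinity. A
   union bound over the vertices is therefore enough for a random bisection that
   cuts the vertices into pairs and splits each pair by a fair coin. It is
   derandomized here by conditional expectations: for t = eps / 2 and k =
   eps^2 / 2, the potential summing, over v and both signs,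
   exp (- k d(v)) (1 +- t)^(d_A(v)) (1 -+ t)^(d_B(v)) starts below 1 and need
   never increase, while a vertex violating the conclusion would contribute at
   least 1 to it. *)
Require Import Defs.
From mathcomp Require Import all_boot all_order all_algebra.
From mathcomp Require Import reals.
From mathcomp Require Import sequences exp.
From mathcomp Require Import ring lra zify.

Import Order.TTheory GRing.Theory Num.Theory.

Local Open Scope ring_scope.

(** The weights [c] are arbitrary so that the induction can absorb into them the factors of the
    pairs already split. [f_sign] makes [f j] of constant sign for each [j], which is what keeps the
    cross term of a pair from raising the sum. *)
Lemma balanced_split (R : realDomainType) (J T : finType) (f : J -> T -> R)
    (f_le1 : forall j u, `|f j u| <= 1)
    (f_sign : forall j u w, 0 <= f j u * f j w)
    (s : seq T) (c : J -> R) :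
  (forall j, 0 <= c j) ->
  exists A B : seq T,
    [/\ perm_eq (A ++ B) s, (size A <= (size B).+1)%N,
        (size B <= (size A).+1)%N
      & \sum_j c j * (\prod_(u <- A) (1 + f j u) * \prod_(u <- B) (1 - f j u))
          <= \sum_j c j].
Proof.
have f1 j u : (0 <= 1 + f j u) /\ (0 <= 1 - f j u).
  by have := f_le1 j u; rewrite ler_norml => /andP[]; split; lra.
(* The two ways of splitting a pair x, y multiply c j by weights whose sum is
   2 (1 - f j x * f j y) <= 2, so one of them does not increase the sum. *)
have [n] := ubnP (size s); elim: n s c => // n IHn [|x [|y s]] c /=.
- move=> _ _; exists [::], [::]; split=> //.
  by apply: ler_sum => j _; rewrite !big_nil !mulr1.
- move=> _ _.
  (* A last unpaired vertex: its two placements average to the current sum, so one of them does not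
     exceed it. *)
  have [le1|gt1] := leP (\sum_j c j * (1 + f j x)) (\sum_j c j).
    exists [:: x], [::]; split=> //.
    rewrite (le_trans _ le1)//; apply: ler_sum => j _.
    by rewrite big_seq1 big_nil mulr1.
  exists [::], [:: x]; split=> //.
  under eq_bigr => j _ do rewrite big_seq1 big_nil mul1r.
  have : \sum_j c j * (1 + f j x) + \sum_j c j * (1 - f j x)
         = \sum_j c j + \sum_j c j.
    by rewrite -!big_split/=; apply: eq_bigr => j _; ring.
  by lra.
rewrite ltnS => size_s c_ge0.
pose c1 j := c j * ((1 + f j x) * (1 - f j y)).
pose c2 j := c j * ((1 + f j y) * (1 - f j x)).
have size_s' : (size s < n)%N by apply: leq_trans size_s.
have c1_ge0 j : 0 <= c1 j.
  by rewrite !mulr_ge0//; [case: (f1 j x) | case: (f1 j y)].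
have c2_ge0 j : 0 <= c2 j.
  by rewrite !mulr_ge0//; [case: (f1 j y) | case: (f1 j x)].
have c12 : \sum_j c1 j + \sum_j c2 j <= \sum_j c j + \sum_j c j.
  rewrite -!big_split/=; apply: ler_sum => j _; rewrite /c1 /c2.
  by have := mulr_ge0 (c_ge0 j) (f_sign j x y); lra.
have [le1|gt1] := leP (\sum_j c1 j) (\sum_j c j).
  have [A [B [pAB sAB sBA le_c1]]] := IHn s c1 size_s' c1_ge0.
  exists (x :: A), (y :: B); split=> //=.
    by rewrite perm_cons (perm_catCA A [:: y] B)/= perm_cons.
  rewrite (le_trans _ le1)// (le_trans _ le_c1)//; apply: ler_sum => j _.
  by rewrite !big_cons /c1 le_eqVlt; apply/orP; left; apply/eqP; ring.
have le2 : \sum_j c2 j <= \sum_j c j by lra.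
have [A [B [pAB sAB sBA le_c2]]] := IHn s c2 size_s' c2_ge0.
exists (y :: A), (x :: B); split=> //=.
  rewrite -cat1s (perm_trans (y := x :: y :: A ++ B))//; last by rewrite !perm_cons.
  by rewrite perm_sym -cat1s perm_sym (perm_catCA (y :: A) [:: x] B).
rewrite (le_trans _ le2)// (le_trans _ le_c2)//; apply: ler_sum => j _.
by rewrite !big_cons /c2 le_eqVlt; apply/orP; left; apply/eqP; ring.
Qed.

Lemma outdeg_inE (T : finType) (e : rel T) (A : {set T}) (v : T) :
  outdeg_in e A v = (\sum_(u in A) e v u)%N.
Proof.
rewrite /outdeg_in -sum1_card; under eq_bigl => u do rewrite inE.
by rewrite big_mkcondr; apply: eq_bigr => u _; case: (e v u).
Qed.

Lemma outdeg_in_count (T : finType) (e : rel T) (A : seq T) (v : T) :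
  uniq A -> outdeg_in e [set u in A] v = count (e v) A.
Proof.
move=> uA; rewrite -size_filter -(card_uniqP (filter_uniq (e v) uA)).
by apply: eq_card => u; rewrite !inE mem_filter andbC.
Qed.

(** Averaging: the arcs inside [S] number |S| (|S| - 1) / 2, and out-degrees in the whole tournament
    are at least those within [S]. *)
Lemma tournament_outdeg_ge (T : finType) (e : rel T) (S : {set T}) :
  tournament e -> S != set0 ->
  exists2 v, v \in S & (#|S| <= (outdeg e v).*2.+1)%N.
Proof.
move=> [e_irr e_tour] S_neq0; apply/exists_inP; apply: contraT.
rewrite negb_exists_in => /forall_inP small.
have small' v : v \in S -> ((outdeg e v).*2.+2 <= #|S|)%N.
  by move=> /small; rewrite -ltnNge.
(* For fixed [v], each [u] other than [v] contributes 1; the extra [#|S|] fills in the zero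
   diagonal. *)
have pairs : (\sum_(v in S) \sum_(u in S) (e v u + e u v) + #|S| = #|S| * #|S|)%N.
  rewrite -sum_nat_const -[X in (_ + X)%N]sum1_card -big_split/=.
  apply: eq_bigr => v vS; rewrite -[RHS]sum1_card.
  rewrite (bigD1 v)//= [RHS](bigD1 v)//= e_irr add0n addnC; congr (_ + _)%N.
  apply: eq_bigr => u /andP[_ u_v]; have := e_tour u v u_v.
  by case: (e u v); case: (e v u).
have double_sum : (\sum_(v in S) \sum_(u in S) (e v u + e u v)
                   <= \sum_(v in S) (outdeg e v).*2)%N.
  under eq_bigr => v _ do rewrite big_split/=.
  rewrite big_split/= [X in (_ + X <= _)%N]exchange_big/= addnn.
  rewrite -(big_morph _ doubleD (erefl 0.*2)) leq_double; apply: leq_sum => v _.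
  by rewrite -outdeg_inE subset_leq_card//; apply/subsetP => u; rewrite !inE => /andP[].
have : (\sum_(v in S) (outdeg e v).*2.+2 <= \sum_(v in S) #|S|)%N.
  exact: leq_sum.
rewrite sum_nat_const -pairs.
under eq_bigr => v _ do rewrite -addn2.
rewrite big_split/= sum_nat_const; have := S_neq0; rewrite -card_gt0.
by lia.
Qed.

(** Repeatedly removing a vertex with 2 d(v) >= |S| - 1 compares the sum with 1 + q + ... + q^(|S| -
    1). *)
Lemma sum_geom_outdeg (R : realFieldType) (T : finType) (e : rel T) (q : R)
    (S : {set T}) :
  tournament e -> 0 <= q < 1 ->
  \sum_(v in S) q ^+ (outdeg e v).*2 <= (1 - q)^-1.
Proof.
move=> e_tour /andP[q_ge0 q_lt1].
(* The finite geometric sum is kept because the bound [(1 - q)^-1] alone does not pass through the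
   induction. *)
suff : (1 - q) * (\sum_(v in S) q ^+ (outdeg e v).*2) <= 1 - q ^+ #|S|.
  move=> le_geom; rewrite -div1r ler_pdivlMr ?subr_gt0// mulrC.
  by rewrite (le_trans le_geom)// gerBl exprn_ge0.
have [n] := ubnP #|S|; elim: n S => // n IHn S.
have [->|S_neq0] := eqVneq S set0.
  by rewrite big_set0 mulr0 cards0 subrr.
have [v vS degv] := tournament_outdeg_ge T e S e_tour S_neq0.
rewrite (big_setD1 v vS)/= (cardsD1 v S) vS ltnS => /IHn.
have : q ^+ (outdeg e v).*2 <= q ^+ #|S :\ v|.
  by apply: ler_wiXn2l; rewrite ?(ltW q_lt1)//; move: degv; rewrite (cardsD1 v S) vS.
rewrite exprS; nra.
Qed.

Lemma expR_le_1D (R : realType) (t : R) :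
  0 <= t <= 1 / 2 ->
  expR (t - 2 * t ^+ 2) <= 1 + t /\ expR (- t - 2 * t ^+ 2) <= 1 - t.
Proof.
move=> /andP[t_ge0 t_le].
(* From exp(-x) >= 1 - x. The two products [y * (1 - x)] are then 1 + t^2 + 2 t^3 and 1 + t^2 - 2
   t^3; the second needs t <= 1/2. *)
have inv (x y : R) : 0 < y -> 1 <= y * (1 - x) -> expR x <= y.
  move=> y_gt0 y1x; have := expR_ge1Dx (- x).
  move=> le_inv; rewrite -[expR x]invrK -expRN -div1r ler_pdivrMr ?expR_gt0//.
  by rewrite (le_trans y1x)// ler_pM2l.
split; apply: inv; nra.
Qed.

Lemma biased_weight_ge1 (R : realType) (eps : R) (a b : nat) :
  0 < eps < 1 / 2 -> b%:R < (1 / 2 - eps) * (a + b)%:R ->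
  1 <= expR (- (eps ^+ 2 / 2) * (a + b)%:R)
       * ((1 + eps / 2) ^+ a * (1 - eps / 2) ^+ b).
Proof.
move=> /andP[eps_gt0 eps_lt] b_small.
have t01 : 0 <= eps / 2 <= 1 / 2 by apply/andP; split; lra.
have [le_p le_m] := expR_le_1D R (eps / 2) t01.
set tp := eps / 2 - _ in le_p; set tm := - (eps / 2) - _ in le_m.
apply: (@le_trans _ _ (expR (- (eps ^+ 2 / 2) * (a + b)%:R)
                       * (expR tp ^+ a * expR tm ^+ b))).
  (* The total exponent equals eps ((1/2 - eps) (a + b) - b), which is [eps] times the slack in
     [b_small]. *)
  rewrite -!expRM_natl -!expRD -[leLHS]expR0 ler_expR /tp /tm.
  move: b_small; rewrite natrD -subr_gt0 -(pmulr_rgt0 _ eps_gt0) => /ltW.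
  by lra.
rewrite ler_pM2l ?expR_gt0//; apply: ler_pM; rewrite ?exprn_ge0 ?expR_ge0//.
  by apply: lerXn2r; rewrite ?nnegrE ?expR_ge0//; lra.
by apply: lerXn2r; rewrite ?nnegrE ?expR_ge0//; lra.
Qed.

Lemma prod_1D_indicator (R : comPzRingType) (T : Type) (p : pred T) (x : R)
    (s : seq T) :
  \prod_(u <- s) (1 + x * (p u)%:R) = (1 + x) ^+ count p s.
Proof.
elim: s => [|u s IHs] /=; first by rewrite big_nil.
rewrite big_cons IHs; case: (p u); first by rewrite mulr1 add1n exprS.
by rewrite mulr0 addr0 mul1r.
Qed.

Lemma min_outdeg_le (T : finType) (e : rel T) (v : T) :
  (min_outdeg e <= outdeg e v)%N.
Proof.
rewrite /min_outdeg; have := mem_index_enum v.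
elim: (index_enum T) => // u s IHs; rewrite inE big_cons geq_min => /orP[/eqP->|/IHs->].
  by rewrite leqnn.
by rewrite orbT.
Qed.

(** Half of the exponent gives a factor that is uniformly small in the minimum out-degree; the other
    half is [q ^+ (outdeg e v).*2], whose sum is bounded independently of [T]. *)
Lemma sum_expR_outdeg_lt (R : realType) (k eta : R) :
  0 < k -> 0 < eta ->
  exists delta0 : nat,
    forall (T : finType) (e : rel T),
      tournament e -> (delta0 <= min_outdeg e)%N ->
      \sum_v expR (- k * (outdeg e v)%:R) < eta.
Proof.
move=> k_gt0 eta_gt0; pose q : R := expR (- k / 4).
have q_lt1 : q < 1 by rewrite -[ltRHS]expR0 ltr_expR; lra.
have q_ge0 : 0 <= q := expR_ge0 _.
have q1_gt0 : 0 < 1 - q by rewrite subr_gt0.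
(* Chosen so that k M / 2 = (1 - q)^-1 / eta. *)
pose M := 2 / k * ((1 - q)^-1 / eta).
have M_ge0 : 0 <= M by rewrite !mulr_ge0 ?invr_ge0 ?ltW.
exists (Num.bound M) => T e e_tour delta_le.
have := archi_boundP M_ge0; set D := Num.bound M in delta_le * => M_lt.
have D_ge0 : 0 <= D%:R :> R by rewrite ler0n.
have den_gt0 : 0 < 1 + k * D%:R / 2 by nra.
have summand v : expR (- k * (outdeg e v)%:R)
    <= (1 + k * D%:R / 2)^-1 * q ^+ (outdeg e v).*2.
  have -> : - k * (outdeg e v)%:R
      = - (k * (outdeg e v)%:R / 2) + (outdeg e v).*2%:R * (- k / 4).
    by rewrite -muln2 natrM; field.
  rewrite expRD expRM_natl ler_wpM2r ?exprn_ge0// expRN.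
  rewrite lef_pV2 ?posrE ?expR_gt0//; apply: le_trans (expR_ge1Dx _).
  have : D%:R <= (outdeg e v)%:R :> R.
    by rewrite ler_nat (leq_trans delta_le)// min_outdeg_le.
  by nra.
rewrite (le_lt_trans (ler_sum _ (fun v _ => summand v)))// -mulr_sumr.
have := sum_geom_outdeg R T e q [set: T] e_tour.
rewrite q_ge0 q_lt1 => /(_ isT).
under eq_bigl => v do rewrite inE.
move=> geom; rewrite mulrC ltr_pdivrMr//; apply: le_lt_trans geom _.
have : (1 - q)^-1 = eta * (k * M / 2).
  by rewrite /M; field; rewrite !gt_eqF.
move=> ->; rewrite ltr_pM2l//.
by nra.
Qed.

Theorem theorem1 (R : realType) (eps : R) (eps_gt0 : 0 < eps)
    (eps_lt_half : eps < 1 / 2) :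
  exists delta0 : nat,
    forall (T : finType) (e : rel T),
      tournament e ->
      (delta0 <= min_outdeg e)%N ->
      exists A B : {set T},
        bisection A B /\
        forall v : T,
          (1 / 2 - eps) * (outdeg e v)%:R
            <= (minn (outdeg_in e A v) (outdeg_in e B v))%:R.
Proof.
have k_gt0 : 0 < eps ^+ 2 / 2 by rewrite divr_gt0 ?exprn_gt0.
(* Each of the two signs gets half of the initial budget 1. *)
have half_gt0 : 0 < 1 / 2 :> R by lra.
have [delta0 sum_lt] := sum_expR_outdeg_lt R _ _ k_gt0 half_gt0.
exists delta0 => T e e_tour delta_le.
pose c v : R := expR (- (eps ^+ 2 / 2) * (outdeg e v)%:R).
have c_lt : \sum_v c v < 1 / 2 := sum_lt T e e_tour delta_le.
pose sgn (b : bool) : R := (-1) ^+ b.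
(* The weight of [(false, v)] grows when [v] has too few out-neighbours in [B], that of [(true, v)]
   when it has too few in [A]. *)
pose f (j : bool * T) (u : T) : R := sgn j.1 * (eps / 2) * (e j.2 u)%:R.
have f_le1 j u : `|f j u| <= 1.
  rewrite /f /sgn; case: j => -[] v /=; case: (e v u) => /=;
    by rewrite ler_norml; apply/andP; split; lra.
have f_sign j u w : 0 <= f j u * f j w.
  rewrite /f /sgn; case: j => -[] v /=; case: (e v u); case: (e v w) => /=; nra.
have c_ge0 (j : bool * T) : 0 <= c j.2 by apply: expR_ge0.
have [A [B [pAB sAB sBA sumW_le]]] :=
  balanced_split R _ T f f_le1 f_sign (enum T) (fun j => c j.2) c_ge0.
pose W j := c j.2 * (\prod_(u <- A) (1 + f j u) * \prod_(u <- B) (1 - f j u)).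
have sumc_lt : \sum_(j : bool * T) c j.2 < 1.
  by rewrite -(pair_bigA _ (fun (_ : bool) v => c v))/= big_bool/=; lra.
have : uniq (A ++ B) by rewrite (perm_uniq pAB) enum_uniq.
rewrite cat_uniq => /and3P[uA AB uB].
have W_lt1 j : W j < 1.
  apply: le_lt_trans sumc_lt; apply: le_trans sumW_le.
  rewrite (bigD1 j)//= lerDl sumr_ge0// => i _.
  rewrite /W !mulr_ge0// prodr_ge0// => u _;
  by have := f_le1 i u; rewrite ler_norml => /andP[]; lra.
have deg v : outdeg e v = (count (e v) A + count (e v) B)%N.
  rewrite -count_cat -outdeg_in_count ?(perm_uniq pAB) ?enum_uniq//.
  congr outdeg_in; apply/setP => u; rewrite !inE.
  by rewrite (perm_mem pAB) mem_enum.
have WE b v : W (b, v) = c v * ((1 + sgn b * (eps / 2)) ^+ count (e v) A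
                              * (1 - sgn b * (eps / 2)) ^+ count (e v) B).
  rewrite /W /f/= prod_1D_indicator; congr (_ * (_ * _)).
  by rewrite -prod_1D_indicator; apply: eq_bigr => u _; rewrite mulNr.
exists [set u in A], [set u in B]; split.
  split; first split.
  - by apply/setP => u; rewrite !inE -mem_cat (perm_mem pAB) mem_enum.
  - rewrite disjoint_subset; apply/subsetP => u; rewrite !inE => uA'.
    by apply: contra AB => uB'; apply/hasP; exists u.
  - by rewrite !cardsE !(card_uniqP _)//; lia.
move=> v; rewrite !outdeg_in_count// /minn; case: ifP => _; rewrite leNgt.
  (* Here [A] is the deficient side, so [biased_weight_ge1] is applied with the two counts
     exchanged. *)
  apply/negP => small; have := W_lt1 (true, v); rewrite WE ltNge => /negP; apply.
  rewrite /c /sgn expr1 mulN1r opprK [X in _ * X]mulrC deg addnC.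
  by apply: biased_weight_ge1; rewrite ?eps_gt0// addnC -deg.
apply/negP => small; have := W_lt1 (false, v); rewrite WE ltNge => /negP; apply.
rewrite /c /sgn expr0 mul1r deg.
by apply: biased_weight_ge1; rewrite ?eps_gt0// -deg.
Qed.
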